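(* Let $\alpha\in\mathbb{R}$ be irrational, with continued fraction expansion $\alpha=[a_0;a_1,a_2,\ldots]$ and sequence of denominators of convergents $\{q_n\}$. For $M\in\mathbb{N}$, $M\ge 1$, let $$T_M(\alpha)=\frac{1}{M}\sum_{m=0}^{M-1}\sum_{n=0}^{M-1}e(nm\alpha).$$ Then there exists a constant $C=C(\alpha)>0$, depending only on $\alpha$, such that for all integers $n\ge 1$, $$|T_{q_n}(\alpha)|\le C\cdot\max\left\{\frac{\log\left(2\cdot\max_{1\le i\le n}a_i\right)}{a_{n+1}},\,1\right\}.$$
   Context: Here $e(x)=e^{2\pi i x}$. The continued fraction expansion $\alpha=[a_0;a_1,a_2,\ldots]$ of the irrational number $\alpha$ has $a_0\in\mathbb{Z}$ and integer partial quotients $a_i\ge 1$ for $i\ge 1$. The convergents are $p_n/q_n=[a_0;a_1,\ldots,a_n]$ with $\gcd(p_n,q_n)=1$ and $q_n\ge 1$; the sequence $\{q_n\}$ is called the sequence of denominators of $\alpha$. *)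

(* Defs.v *)
From mathcomp Require Import all_boot all_order all_algebra.
From mathcomp Require Import complex.
From mathcomp Require Import all_classical all_reals all_analysis.

Set Implicit Arguments.
Unset Strict Implicit.
Unset Printing Implicit Defensive.

Import Order.TTheory GRing.Theory Num.Theory.
Import numFieldNormedType.Exports.

Local Open Scope classical_set_scope.
Local Open Scope ring_scope.
Local Open Scope complex_scope.

(* The finite continued fraction [a 0; a 1, ..., a n]. *)
Fixpoint cf_convergent (a : nat -> int) (n : nat) : rat :=
  if n is n'.+1 then (a 0%N)%:~R + (cf_convergent (fun i => a i.+1) n')^-1
  else (a 0%N)%:~R.

(* alpha = [a 0; a 1, a 2, ...]; for irrational alpha there is exactly one
   such sequence a. *)
Definition cf_expansion (R : realType) (alpha : R) (a : nat -> int) : Prop :=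
  (forall i, (1 <= i)%N -> 1 <= a i) /\
  (fun n => ratr (cf_convergent a n) : R) @ \oo --> alpha.

(* denq is positive and coprime to numq, so the absolute value only serves
   as the conversion from int to nat. *)
Definition cf_denominator (a : nat -> int) (n : nat) : nat :=
  `|denq (cf_convergent a n)|%N.

Definition e (R : realType) (x : R) : R[i] :=
  cos (2 * pi * x) +i* sin (2 * pi * x).

Definition T (R : realType) (alpha : R) (M : nat) : R[i] :=
  M%:R^-1 * \sum_(0 <= m < M) \sum_(0 <= n < M) e (n%:R * m%:R * alpha).

(* Main.v *)
Require Import Defs.
From mathcomp Require Import all_boot all_order all_algebra.
From mathcomp Require Import complex.
From mathcomp Require Import all_classical all_reals all_analysis.
From mathcomp Require Import zify ring lra.
Import Order.TTheory GRing.Theory Num.Theory.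
Import numFieldNormedType.Exports.
Local Open Scope ring_scope.
Local Open Scope complex_scope.

(** Write q = q_n, alpha = p/q + delta with |delta| <= 1/(a_{n+1} q^2), and let
u be the inverse of p modulo q.  The inner sums G_m = sum_k e(k m alpha) are
geometric with ratio e(mp/q) e(m delta).  Since e(mp/q) is a q-th root of
unity, G_m is close to (e(q m delta) - 1) / (e(mp/q) - 1), with an error
O(1/q) / |e(mp/q) - 1|^2 (inner_sum_approx) that sums over m to O(q).
Substituting m = (u r mod q) turns e(mp/q) into e(r/q), so the denominator
becomes explicit and the numerator becomes a smooth function of
y_r = {r u / q}, of size and Lipschitz constant O(1/a_{n+1}).

As 1/(e(t) - 1) = -1/2 - (i/2) cot(pi t), the remaining task is to bound
sum_r F(y_r) cot(pi r/q) by O(q log(2 max a_i)) times the Lipschitz constant of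
F.  A termwise estimate would produce log q instead.  The cotangent has only the
two poles 1/(pi t) and -1/(pi (1 - t)) on (0,1) up to a bounded function
(cot_two_poles), and r -> q - r folds them onto each other: what is left is
(q/pi) sum_r h(y_r)/r with h(y) = F(y) - F(1 - y), which is odd about 1/2.

The cancellation in sum_r h(y_r)/r is a Denjoy-Koksma phenomenon
(denjoy_koksma): over any block whose length is the denominator Q of a good
approximation of u/q, the points y_r are matched with the midpoints of the grid
of mesh 1/Q, on which h sums to 0 because it is odd.  So each block sum is O(V)
with V bounded in terms of the Lipschitz constant.  The denominators to use are
Q_0 = 1, Q_1, ..., Q_n = q, the convergents' denominators of
q_{n-1}/q_n = [0; a_n, ..., a_1]: indeed u = +-q_{n-1} modulo q.  Cutting a sum
of length r into blocks greedily and summing by parts against 1/r gives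
V sum_j (1 + log(Q_{j+1}/Q_j)) / Q_j (weighted_sum_invariant).  Each logarithm is
at most log(2 max a_i), and the sum of 1/Q_j converges because
Q_{j+2} >= 2 Q_j, so only O(V (1 + log(2 max a_i))) remains. *)

(** * Continued fractions and their reversal *)

Fixpoint continuant (x0 x1 : int) (a : nat -> int) (n : nat) : int :=
  match n with
  | 0%N => x0
  | m.+1 => match m with
            | 0%N => x1
            | k.+1 => a m * continuant x0 x1 a m + continuant x0 x1 a k
            end
  end.

(** The indices are shifted by one so that the recursion starts from the formal
convergent 1/0: the n-th convergent is cfnum a n.+1 / cfden a n.+1. *)
Definition cfnum (a : nat -> int) : nat -> int := continuant 1 (a 0%N) a.
Definition cfden (a : nat -> int) : nat -> int := continuant 0 1 a.

Lemma cfdenSS a n : cfden a n.+2 = a n.+1 * cfden a n.+1 + cfden a n.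
Proof. by []. Qed.

Lemma cfnumSS a n : cfnum a n.+2 = a n.+1 * cfnum a n.+1 + cfnum a n.
Proof. by []. Qed.

Definition positive_quotients (a : nat -> int) :=
  forall i, (1 <= i)%N -> 1 <= a i.

Lemma cfden_ge (a : nat -> int) (ha : positive_quotients a) n :
  0 <= cfden a n /\ 1 <= cfden a n.+1.
Proof.
elim: n => [//|n [h0 h1]]; split; first exact: le_trans h1.
rewrite cfdenSS; have := ha n.+1 isT; nia.
Qed.

Lemma cfden_ge0 a (ha : positive_quotients a) n : 0 <= cfden a n.
Proof. by have [] := cfden_ge a ha n. Qed.

Lemma cfden_ge1 a (ha : positive_quotients a) n : 1 <= cfden a n.+1.
Proof. by have [] := cfden_ge a ha n. Qed.

Lemma cfden_leS a (ha : positive_quotients a) n : cfden a n <= cfden a n.+1.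
Proof.
case: n => [//|n]; rewrite cfdenSS.
have := ha n.+1 isT; have := cfden_ge0 a ha n; have := cfden_ge1 a ha n; nia.
Qed.

Lemma cf_det a n :
  cfnum a n.+1 * cfden a n - cfnum a n * cfden a n.+1 = (-1) ^+ n.+1.
Proof.
elim: n => [|n IH]; first by rewrite /= mulr0 sub0r mulr1 expr1.
by rewrite cfnumSS cfdenSS exprS -IH; ring.
Qed.

Lemma cf_coprime a n : coprimez (cfnum a n.+1) (cfden a n.+1).
Proof.
apply/coprimezP; exists ((-1) ^+ n.+1 * cfden a n, - ((-1) ^+ n.+1 * cfnum a n)).
rewrite /=; transitivity ((-1) ^+ n.+1 *
  (cfnum a n.+1 * cfden a n - cfnum a n * cfden a n.+1)); first by ring.
by rewrite cf_det -expr2 sqrr_sign.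
Qed.

Lemma cf_convergent_ge (a : nat -> int) (ha : positive_quotients a) m :
  (a 0%N)%:~R <= cf_convergent a m.
Proof.
elim: m a ha => [//|m IH] a ha /=.
have ha' : positive_quotients (fun i => a i.+1) by move=> i _; exact: ha.
rewrite lerDl invr_ge0; apply: le_trans (IH _ ha').
by rewrite ler0z; apply: le_trans (ha 1%N isT).
Qed.

Lemma cf_convergent_tail_ge (a : nat -> int) (ha : positive_quotients a) n m :
  (a n.+1)%:~R <= cf_convergent (fun i => a (i + n.+1)%N) m.
Proof.
by apply: cf_convergent_ge => i hi; apply: ha; rewrite addnS.
Qed.

(** The convergents are defined by unfolding from the first quotient, the
continuants by recursion on the last one.  Inserting an arbitrary tail t as the
last complete quotient makes the two compatible, and gives at the same time the
distance between a convergent and all later ones. *)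
Lemma cf_convergent_split (a : nat -> int) (ha : positive_quotients a) n m :
  let t := cf_convergent (fun i => a (i + n.+1)%N) m in
  cf_convergent a (n.+1 + m) =
  ((cfnum a n.+1)%:~R * t + (cfnum a n)%:~R) /
  ((cfden a n.+1)%:~R * t + (cfden a n)%:~R).
Proof.
elim: n m => [|n IH] m t.
  have t0 : 0 < t.
    apply: lt_le_trans (cf_convergent_tail_ge a ha 0 m).
    by rewrite ltr0z; apply: lt_le_trans (ha 1%N isT).
  rewrite add1n /= mul1r addr0.
  have -> : (fun i => a i.+1) = (fun i => a (i + 1)%N).
    by apply/funext => i; rewrite addn1.
  by rewrite -/t; field; rewrite gt_eqF.
rewrite addSnnS IH /=.
have -> : (fun i => a (i.+1 + n.+1)%N) = (fun i => a (i + n.+2)%N).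
  by apply/funext => i; rewrite addSnnS.
rewrite -/t add0n.
have t0 : 0 < t.
  apply: lt_le_trans (cf_convergent_tail_ge a ha n.+1 m).
  by rewrite ltr0z; apply: lt_le_trans (ha n.+2 isT).
have d0 : 0 < (cfden a n.+2)%:~R * t + (cfden a n.+1)%:~R.
  apply: ltr_wpDr; first by rewrite ler0z cfden_ge0.
  by rewrite mulr_gt0 // ltr0z; apply: lt_le_trans (cfden_ge1 a ha n.+1).
rewrite cfdenSS cfnumSS in d0 *.
rewrite !rmorphD !rmorphM /= in d0 *.
by field; rewrite ?gt_eqF.
Qed.

Lemma cf_convergentE (a : nat -> int) (ha : positive_quotients a) n :
  cf_convergent a n = (cfnum a n.+1)%:~R / (cfden a n.+1)%:~R.
Proof.
case: n => [|n]; first by rewrite /= divr1.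
rewrite -[n.+1]addn0 cf_convergent_split // addn0 /= add0n.
by rewrite -!rmorphM -!rmorphD /= ![_ * a _]mulrC.
Qed.

Lemma cf_denominatorE (a : nat -> int) (ha : positive_quotients a) n :
  (cf_denominator a n)%:Z = cfden a n.+1.
Proof.
have q1 := cfden_ge1 a ha n.
have q0 : 0 < cfden a n.+1 by exact: lt_le_trans q1.
rewrite /cf_denominator cf_convergentE // coprimeq_den; last exact: cf_coprime.
by rewrite (gt_eqF q0) absz_id gez0_abs // ltW.
Qed.

(** By the determinant identity the distance is exactly 1 / (q (q t + q')) with
q' >= 0, and the tail t is at least the next quotient. *)
Lemma cf_convergent_dist (a : nat -> int) (ha : positive_quotients a) n m :
  `|cf_convergent a (n.+1 + m) - (cfnum a n.+1)%:~R / (cfden a n.+1)%:~R| <=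
  ((a n.+1)%:~R * (cfden a n.+1)%:~R ^+ 2)^-1 :> rat.
Proof.
rewrite cf_convergent_split //=.
have ht := cf_convergent_tail_ge a ha n m.
set t := cf_convergent _ _ in ht *.
have a1 : 1 <= (a n.+1)%:~R :> rat by rewrite ler1z ha.
have q1 : 1 <= (cfden a n.+1)%:~R :> rat by rewrite ler1z cfden_ge1.
have q0 : 0 <= (cfden a n)%:~R :> rat by rewrite ler0z cfden_ge0.
have := congr1 (fun z : int => z%:~R : rat) (cf_det a n).
rewrite /= rmorphB !rmorphM /= rmorph_sign.
move: ht a1 q1 q0; set p := (cfnum a n.+1)%:~R; set p' := (cfnum a n)%:~R.
set q := (cfden a n.+1)%:~R; set q' := (cfden a n)%:~R; set c := (a n.+1)%:~R.
move=> ht a1 q1 q0 hd.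
have d0 : 0 < q * t + q' by nra.
have qp : 0 < q by lra.
have -> : (p * t + p') / (q * t + q') - p / q =
          - (-1) ^+ n.+1 / (q * (q * t + q')).
  by rewrite -hd; by field; rewrite ?gt_eqF.
rewrite normrM normrN normrX normrN1 expr1n mul1r ger0_norm; last first.
  by rewrite invr_ge0 mulr_ge0 // ltW.
rewrite lef_pV2 ?posrE ?mulr_gt0 ?exprn_gt0 //; last by lra.
have : q * q * c <= q * q * t by rewrite ler_pM2l // mulr_gt0.
by rewrite expr2; nra.
Qed.

Lemma cf_expansion_dist (R : realType) (alpha : R) (a : nat -> int)
    (ha : cf_expansion alpha a) n :
  `|alpha - (cfnum a n.+1)%:~R / (cfden a n.+1)%:~R| <=
  ((a n.+1)%:~R * (cfden a n.+1)%:~R ^+ 2)^-1.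
Proof.
case: ha => ha cva.
apply/ler_addgt0Pr => eps eps0.
have [N _ hN] := (cvgrPdist_lt _ _).1 cva eps eps0.
have /= hk : (N <= n.+1 + N)%N by rewrite leq_addl.
have {hN hk} := hN _ hk.
set u := cf_convergent _ _ => hu.
rewrite -[alpha](subrK (ratr u)) -addrA addrC.
apply: le_trans (ler_normD _ _) _; apply: lerD; last exact: ltW.
have := cf_convergent_dist a ha n N; rewrite -/u -(ler_rat R) ratr_norm.
by rewrite rmorphB fmorphV fmorph_div rmorphM rmorphXn /= !ratr_int.
Qed.

(** The expansion [0; a n, ..., a 1].  Beyond index n it is continued by a 1
forever: only the first n quotients matter, but an infinite positive sequence
makes the growth of the denominators unconditional. *)
Definition reversed_cf (a : nat -> int) (n : nat) : nat -> int :=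
  fun k => if k is k'.+1 then a (n - k').-1.+1 else 0.

Lemma reversed_cf_positive a (ha : positive_quotients a) n :
  positive_quotients (reversed_cf a n).
Proof. by case=> [//|i] _ /=; apply: ha. Qed.

(** Splitting the continuant of (a 1, ..., a n) after its (n-j)-th entry. *)
Lemma reversed_cf_den a n j : (j <= n)%N ->
  cfden a n.+1 =
  cfden (reversed_cf a n) j.+1 * cfden a (n - j).+1 +
  cfden (reversed_cf a n) j * cfden a (n - j).
Proof.
elim: j => [|j IH] hj; first by rewrite subn0 /= mul1r mul0r addr0.
rewrite (IH (ltnW hj)) (cfdenSS (reversed_cf a n)) /= -subnSK //.
by rewrite cfdenSS /=; ring.
Qed.

(** Running Euclid's algorithm on the pair (q_n, q_{n-1}) returns the earlier
denominators of a as successive remainders; hence the convergents of the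
reversed expansion approximate q_{n-1}/q_n with these remainders as errors. *)
Lemma reversed_cf_convergent a n j : (j <= n)%N ->
  cfden a n * cfden (reversed_cf a n) j.+1 -
  cfden a n.+1 * cfnum (reversed_cf a n) j.+1 = (-1) ^+ j * cfden a (n - j).
Proof.
pose C j := cfden a n * cfden (reversed_cf a n) j.+1 -
  cfden a n.+1 * cfnum (reversed_cf a n) j.+1 = (-1) ^+ j * cfden a (n - j).
suff H : (j <= n)%N -> C j /\ (j < n -> C j.+1)%N by case/H.
elim: j => [|j IH] hj.
  split; first by rewrite /C /= subn0; ring.
  case: n {hj} @C => // n C _; rewrite /C cfdenSS cfnumSS /= subSS subn0.
  by rewrite cfdenSS; ring.
have [h0 /(_ hj) h1] := IH (ltnW hj); split=> // hj2.
have : C j by []; have : C j.+1 by [].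
rewrite /C => e1 e0; rewrite cfdenSS cfnumSS [reversed_cf _ _ j.+2]/=.
have -> : (n - j.+1).-1.+1 = (n - j.+1)%N by lia.
have d : cfden a (n - j) =
  a (n - j.+1)%N * cfden a (n - j.+1) + cfden a (n - j.+2).
  by rewrite -(subnSK hj) -(subnSK hj2) cfdenSS.
rewrite d in e0.
transitivity (a (n - j.+1)%N *
   (cfden a n * cfden (reversed_cf a n) j.+2 -
    cfden a n.+1 * cfnum (reversed_cf a n) j.+2) +
   (cfden a n * cfden (reversed_cf a n) j.+1 -
    cfden a n.+1 * cfnum (reversed_cf a n) j.+1)); first by ring.
by rewrite e1 e0 !exprS; ring.
Qed.

(** * Sums over blocks whose length is a good denominator *)

Lemma sum_affine_mod (V : nmodType) (F : nat -> V) (Q : nat) (c P : int) :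
  (0 < Q)%N -> coprimez P Q ->
  \sum_(i < Q) F `|((c + P * i%:Z) %% Q)%Z|%N = \sum_(i < Q) F i.
Proof.
case: Q => // Q _ cop.
have lt_mod z : (`|(z %% Q.+1)%Z| < Q.+1)%N.
  by rewrite -ltz_nat gez0_abs ?modz_ge0 // ltz_pmod.
pose f (i : 'I_Q.+1) := inord `|((c + P * i%:Z) %% Q.+1)%Z|%N : 'I_Q.+1.
have f_inj : injective f.
  move=> i j /(congr1 val); rewrite /= !inordK //.
  move=> /(congr1 Posz); rewrite !gez0_abs ?modz_ge0 // => /eqP.
  rewrite eqz_mod_dvd opprD addrACA subrr add0r -mulrBr.
  rewrite Gauss_dvdzr 1?coprimez_sym // -eqz_mod_dvd.
  have small (k : 'I_Q.+1) : (k%:Z %% Q.+1)%Z = k.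
    by rewrite modz_small // lez_nat leq0n ltz_nat ltn_ord.
  by rewrite !small; move=> /eqP [] /val_inj.
rewrite [RHS](reindex_inj f_inj).
by apply: eq_bigr => i _; rewrite inordK.
Qed.

Definition frac (R : realType) (x : R) : R := x - (Num.floor x)%:~R.

Lemma frac_itv (R : realType) (x : R) : 0 <= frac R x < 1.
Proof.
have /andP[h1 h2] := floor_itv x; rewrite /frac.
by rewrite rmorphD /= in h2; lra.
Qed.

Lemma frac_eq (R : realType) (x : R) (l : int) (y : R) :
  0 <= y < 1 -> x = l%:~R + y -> frac R x = y.
Proof.
move=> hy ->; rewrite /frac (@floor_def _ _ l); first by ring.
by rewrite rmorphD /=; lra.
Qed.

Lemma sum_odd_grid (R : realType) (h : R -> R) (Q : nat) :
  (0 < Q)%N -> (forall y, h (1 - y) = - h y) ->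
  \sum_(k < Q) h ((k%:R + 2^-1) / Q%:R) = 0.
Proof.
move=> Q0 hodd; set S := LHS.
suff : S = - S by lra.
rewrite {1}/S (reindex_inj rev_ord_inj) /= /S -sumrN.
apply: eq_bigr => k _; rewrite -hodd; congr h.
rewrite natrB ?ltn_ord // -natr1; field.
by rewrite pnatr_eq0 -lt0n.
Qed.

Lemma sum_singletons (R : realType) (Q j : nat) (x : R) : (j < Q)%N ->
  \sum_(k < Q) (if k == j :> nat then x else 0) = x.
Proof.
move=> jQ; rewrite (bigD1 (Ordinal jQ)) //= eqxx big1 ?addr0 // => i.
by rewrite -val_eqE /= => /negbTE ->.
Qed.

(** A point displaced by at most 3/2 of a mesh from the midpoint of its cell is
compared with that midpoint by the Lipschitz bound.  In the two extreme cells the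
displacement may wrap around the circle, where h can jump, so there only the
trivial bound 2 B is available. *)
Lemma near_grid_point (R : realType) (h : R -> R) (B : R) (Q k : nat) (l : int)
    (t : R) :
  (forall y : R, 0 <= y <= 1 -> `|h y| <= B) ->
  (forall x y : R, 0 <= x <= 1 -> 0 <= y <= 1 -> `|h x - h y| <= B * `|x - y|) ->
  (k < Q)%N ->
  k%:R - 1 <= Q%:R * (t - l%:~R) < k%:R + 2 ->
  `|h (frac R t) - h ((k%:R + 2^-1) / Q%:R)| <=
  3 / 2 * B / Q%:R + (if k == 0%N then 2 * B else 0) +
  (if k == Q.-1 then 2 * B else 0).
Proof.
move=> hB hL kQ ht.
have B0 : 0 <= B by apply: le_trans (hB 0 _); rewrite ?lexx ?ler01.
have Q0 : 0 < Q%:R :> R by rewrite ltr0n; apply: leq_ltn_trans kQ.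
have kQ1 : k%:R + 1 <= Q%:R :> R by rewrite natr1 ler_nat.
have k0 : 0 <= k%:R :> R by exact: ler0n.
have g01 : 0 <= (k%:R + 2^-1 : R) / Q%:R <= 1.
  by rewrite divr_ge0 ?(ltW Q0) ?ler_pdivrMr //=; lra.
have := frac_itv R t => f01.
have triv : `|h (frac R t) - h ((k%:R + 2^-1) / Q%:R)| <= 2 * B.
  apply: le_trans (ler_normB _ _) _.
  have := hB _ g01; have := hB (frac R t); lra.
have e0 : 0 <= 3 / 2 * B / Q%:R by rewrite divr_ge0 ?(ltW Q0) //; lra.
have [k00|k00] := eqVneq k 0%N; first by case: ifP => _; lra.
have [kQQ|kQQ] := eqVneq k Q.-1; first by lra.
have k1 : 1 <= k%:R :> R by rewrite ler1n lt0n.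
have kQ2 : k%:R + 2 <= Q%:R :> R.
  by rewrite -[2]/(2%:R) -natrD ler_nat; clear -k00 kQQ kQ; lia.
rewrite !addr0.
have y01 : 0 <= t - l%:~R < 1.
  by rewrite -(pmulr_rge0 _ Q0) -(ltr_pM2l Q0) mulr1; lra.
rewrite (frac_eq R t l (t - l%:~R)) ?subrKC //.
apply: le_trans (hL _ _ _ g01) _; first by lra.
rewrite [3 / 2 * B]mulrC -mulrA ler_wpM2l //.
have -> : t - l%:~R - (k%:R + 2^-1) / Q%:R =
          (Q%:R * (t - l%:~R) - (k%:R + 2^-1)) / Q%:R.
  by field; rewrite gt_eqF.
rewrite normrM normfV [`|Q%:R|]gtr0_norm // ler_wpM2r ?invr_ge0 ?(ltW Q0) //.
by rewrite ler_norml; lra.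
Qed.

(** Modulo 1, the points (s + i) beta for i < Q are the shifted rational points
s beta + i P / Q moved by at most 1/Q.  Since P is prime to Q, exactly one of
the rational points lies in each cell of mesh 1/Q, and the sum of h over the
midpoints of the cells is 0 by oddness. *)
Lemma denjoy_koksma (R : realType) (h : R -> R) (B beta : R) (Q : nat) (P : int) :
  (forall y : R, 0 <= y <= 1 -> `|h y| <= B) ->
  (forall x y : R, 0 <= x <= 1 -> 0 <= y <= 1 -> `|h x - h y| <= B * `|x - y|) ->
  (forall y, h (1 - y) = - h y) ->
  (0 < Q)%N -> coprimez P Q -> `|Q%:R * beta - P%:~R| <= Q%:R^-1 ->
  forall s : nat,
    `|\sum_(i < Q) h (frac R ((s + i)%:R * beta))| <= 6 * B.
Proof.
move=> hB hL hodd Q0 cop hP s.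
have B0 : 0 <= B by apply: le_trans (hB 0 _); rewrite ?lexx ?ler01.
have Q0' : 0 < Q%:R :> R by rewrite ltr0n.
(* The cell containing s beta + i P / Q is numbered c + P i modulo Q. *)
pose c := Num.floor (Q%:R * (s%:R * beta)).
pose k (i : nat) := `|((c + P * i%:Z) %% Q)%Z|%N.
pose g (k : nat) := h ((k%:R + 2^-1) / Q%:R).
pose ep (k : nat) := 3 / 2 * B / Q%:R + (if k == 0%N then 2 * B else 0) +
  (if k == Q.-1 then 2 * B else 0).
have sg : \sum_(i < Q) g (k i) = 0.
  by rewrite (sum_affine_mod _ g) // sum_odd_grid.
have kE (i : nat) : (k i)%:Z = ((c + P * i%:Z) %% Q)%Z.
  by rewrite gez0_abs // modz_ge0 // -lt0n.
have near (i : 'I_Q) : `|h (frac R ((s + i)%:R * beta)) - g (k i)| <= ep (k i).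
  apply: (near_grid_point _ _ _ _ _ ((c + P * i%:Z) %/ Q)%Z) => //.
    by rewrite -ltz_nat kE ltz_pmod.
  have /(congr1 (fun z : int => z%:~R : R)) /= := divz_eq (c + P * i%:Z) Q.
  rewrite -kE rmorphD rmorphM /= [X in _ = X]rmorphD rmorphM /= => e1.
  have -> : (k i)%:R = (k i)%:~R :> R by [].
  have /andP[c1 c2] := floor_itv (Q%:R * (s%:R * beta)).
  rewrite -/c rmorphD /= in c1 c2.
  have : `|i%:R * (Q%:R * beta - P%:~R)| <= 1.
    rewrite normrM ger0_norm // (le_trans (ler_wpM2l _ hP)) //.
    by rewrite ler_pdivrMr // mul1r ler_nat ltnW.
  rewrite ler_norml natrD => /andP[n1 n2].
  set l := (_ %/ _)%Z in e1 *.
  apply/andP; split; move: e1 c1 c2 n1 n2; rewrite -!pmulrn; nra.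
have -> : \sum_(i < Q) h (frac R ((s + i)%:R * beta)) =
    \sum_(i < Q) (h (frac R ((s + i)%:R * beta)) - g (k i)).
  by rewrite sumrB sg subr0.
apply: le_trans (ler_norm_sum _ _ _) _.
apply: le_trans (ler_sum _ (fun i _ => near i)) _.
rewrite (sum_affine_mod _ ep) // /ep !big_split /= !sum_singletons ?prednK //.
rewrite sumr_const card_ord -[_ *+ Q]mulr_natr divfK ?gt_eqF //; lra.
Qed.

(** * Summation by parts along a chain of denominators *)

(** A sum of length r contains at most r / Q full blocks of length Q; the start
s is arbitrary so that the remainder is again a sum of the same kind. *)
Lemma block_sum_step (R : realType) (x : nat -> R) (Q : nat) (V W : R) :
  (0 < Q)%N -> 0 <= V ->
  (forall s, `|\sum_(i < Q) x (s + i)%N| <= V) ->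
  (forall s r, (r < Q)%N -> `|\sum_(i < r) x (s + i)%N| <= W) ->
  forall s r, `|\sum_(i < r) x (s + i)%N| <= V * (r%:R / Q%:R) + W.
Proof.
move=> Q0 V0 hV hW s r; have [m] := ubnP r; elim: m r s => // m IH r s hm.
have Q0' : 0 < Q%:R :> R by rewrite ltr0n.
have [rQ|Qr] := ltnP r Q.
  apply: le_trans (hW s r rQ) _; rewrite lerDr mulr_ge0 // divr_ge0.
rewrite -(subnKC Qr) big_split_ord /=.
apply: le_trans (ler_normD _ _) _.
have h2 := IH (r - Q)%N (s + Q)%N ltac:(lia).
under [X in `|_| + `|X|]eq_bigr do rewrite addnA.
apply: le_trans (lerD (hV s) h2) _.
rewrite natrD mulrDl divff ?gt_eqF //; lra.
Qed.

(** Up to the factor V, this bounds all sums of length less than Q j: the greedy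
decomposition uses at most Q i.+1 / Q i blocks of length Q i for each i < j. *)
Definition ratio_sum (R : realType) (Q : nat -> nat) (j : nat) : R :=
  \sum_(i < j) (Q i.+1)%:R / (Q i)%:R.

Lemma ratio_sum_ge0 (R : realType) Q j : 0 <= ratio_sum R Q j.
Proof. by apply: sumr_ge0 => i _; rewrite divr_ge0. Qed.

Lemma short_sum_bound (R : realType) (x : nat -> R) (Q : nat -> nat) (N : nat)
    (V : R) :
  Q 0%N = 1%N -> (forall i, (0 < Q i)%N) -> 0 <= V ->
  (forall j s, (j < N)%N -> `|\sum_(i < Q j) x (s + i)%N| <= V) ->
  forall j, (j <= N)%N -> forall s r, (r < Q j)%N ->
    `|\sum_(i < r) x (s + i)%N| <= V * ratio_sum R Q j.
Proof.
move=> Q01 Qpos V0 hV; elim=> [|j IH] hj s r hr.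
  by move: hr; rewrite Q01 ltnS leqn0 => /eqP ->; rewrite /ratio_sum !big_ord0 normr0 mulr0.
apply: le_trans (block_sum_step _ _ _ _ _ (Qpos j) V0 _ (IH (ltnW hj)) s r) _.
  by move=> s'; exact: hV.
rewrite /ratio_sum big_ord_recr /= -/(ratio_sum R Q j) mulrDr addrC lerD2l.
by rewrite ler_wpM2l // ler_pM2r ?invr_gt0 ?ltr0n // ler_nat ltnW.
Qed.

Lemma harmonic_le_ln (R : realType) (a b : nat) : (0 < a)%N -> (a <= b)%N ->
  \sum_(a <= r < b) (r.+1%:R : R)^-1 <= ln (b%:R / a%:R).
Proof.
move=> a0 ab.
have pos (n : nat) : (a <= n)%N -> 0 < n%:R :> R by rewrite ltr0n; lia.
rewrite ln_div ?posrE ?pos // -(telescope_sumr (fun n => ln n%:R)) //.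
apply: ler_sum_nat => r /andP[ar _].
have r0 := pos _ ar; have r1 := pos _ (leqW ar).
rewrite -[X in _ <= X]opprB lerNr -ln_div ?posrE //.
have -> : r%:R / r.+1%:R = 1 + - r.+1%:R^-1 :> R.
  by rewrite -natr1 in r1 *; field; rewrite gt_eqF.
apply: le_ln1Dx; rewrite ltrN2 invf_lt1 //.
by rewrite ltr1n ltnS; apply: leq_trans ar.
Qed.

Lemma sum_inv_consecutive (R : realType) (a b : nat) : (0 < a)%N -> (a <= b)%N ->
  \sum_(a <= r < b) (r%:R * r.+1%:R : R)^-1 = a%:R^-1 - b%:R^-1.
Proof.
move=> a0 ab.
rewrite (telescope_sumr_eq (fun n => - n%:R^-1)) //; first by ring.
move=> k /andP[ak _]; rewrite -natr1; field.
by rewrite natr1 !pnatr_eq0 /=; lia.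
Qed.

Lemma abel_harmonic (R : realType) (x : nat -> R) n :
  \sum_(i < n) x i.+1 / i.+1%:R =
  \sum_(1 <= r < n.+1) (\sum_(i < r) x i.+1) / (r%:R * r.+1%:R) +
  (\sum_(i < n) x i.+1) / n.+1%:R.
Proof.
elim: n => [|n IH]; first by rewrite !big_ord0 big_geq // mul0r addr0.
rewrite big_ord_recr /= IH [in RHS]big_nat_recr //= -!addrA; congr (_ + _).
rewrite [in RHS]big_ord_recr /=; set S := \sum_(i < n) _.
by rewrite -!natr1; field; rewrite !natr1 !pnatr_eq0.
Qed.

(** The second term on the left absorbs the contribution of ratio_sum: on
[Q j, Q j.+1[ the constant bound V * ratio_sum j costs
V * ratio_sum j * (1 / Q j - 1 / Q j.+1), and summation by parts over j replaces
ratio_sum by its increments Q j.+1 / Q j, leaving only V / Q j.  The term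
proportional to the length costs V / Q j times a piece of the harmonic series. *)
Lemma weighted_sum_invariant (R : realType) (x : nat -> R) (Q : nat -> nat)
    (N : nat) (V : R) :
  Q 0%N = 1%N -> (forall i, (0 < Q i)%N) -> (forall i, (Q i <= Q i.+1)%N) ->
  0 <= V ->
  (forall j s, (j < N)%N -> `|\sum_(i < Q j) x (s + i)%N| <= V) ->
  forall j, (j <= N)%N ->
  \sum_(1 <= r < Q j) `|\sum_(i < r) x i.+1| / (r%:R * r.+1%:R) +
    V * ratio_sum R Q j / (Q j)%:R <=
  V * \sum_(i < j) (1 + ln ((Q i.+1)%:R / (Q i)%:R)) / (Q i)%:R.
Proof.
move=> Q01 Qpos QS V0 hV; elim=> [|j IH] hj.
  by rewrite Q01 big_geq // /ratio_sum !big_ord0 mulr0 mul0r addr0.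
have {}IH := IH (ltnW hj).
have p0 : 0 < (Q j)%:R :> R by rewrite ltr0n.
have p1 : 0 < (Q j.+1)%:R :> R by rewrite ltr0n.
have shortb := short_sum_bound _ _ _ _ _ Q01 Qpos V0 hV _ (ltnW hj).
have hr (r : nat) : `|\sum_(i < r) x i.+1| <=
    V * (r%:R / (Q j)%:R) + V * ratio_sum R Q j.
  have := block_sum_step _ _ _ _ _ (Qpos j) V0 (fun s => hV j s hj) shortb 1%N r.
  by under eq_bigr do rewrite add1n.
have hblock : \sum_(Q j <= r < Q j.+1) `|\sum_(i < r) x i.+1| / (r%:R * r.+1%:R) <=
  V / (Q j)%:R * ln ((Q j.+1)%:R / (Q j)%:R) +
  V * ratio_sum R Q j * ((Q j)%:R^-1 - (Q j.+1)%:R^-1).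
  rewrite -sum_inv_consecutive //.
  apply: le_trans (lerD (ler_wpM2l _ (harmonic_le_ln R _ _ (Qpos j) (QS j))) (lexx _)).
    rewrite [V / _ * _]mulr_sumr [V * _ * _]mulr_sumr -big_split /=; apply: ler_sum_nat => r /andP[jr _].
    have r0 : 0 < r%:R :> R by rewrite ltr0n; apply: leq_trans jr.
    apply: le_trans (ler_wpM2r _ (hr r)) _; first by rewrite invr_ge0 mulr_ge0.
    rewrite le_eqVlt; apply/orP; left; apply/eqP.
    by rewrite -natr1; field; rewrite natr1 pnatr_eq0 !gt_eqF.
  by rewrite divr_ge0.
rewrite (big_cat_nat (Qpos j) (QS j)) /= big_ord_recr /= mulrDr.
have -> : ratio_sum R Q j.+1 = ratio_sum R Q j + (Q j.+1)%:R / (Q j)%:R.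
  by rewrite /ratio_sum big_ord_recr.
have e1 : V * (ratio_sum R Q j + (Q j.+1)%:R / (Q j)%:R) / (Q j.+1)%:R =
  V * ratio_sum R Q j * (Q j.+1)%:R^-1 + V / (Q j)%:R.
  by field; rewrite !gt_eqF.
rewrite e1 mulrDl mul1r; lra.
Qed.

(** Since the even and the odd subsequence each at least double, adding
2 / Q k + 2 / Q k.+1 to the partial sums makes them nonincreasing. *)
Lemma sum_inv_denominators (R : realType) (Q : nat -> nat) (k : nat) :
  (forall i, (0 < Q i)%N) -> (forall i, (2 * Q i <= Q i.+2)%N) ->
  \sum_(i < k) ((Q i)%:R : R)^-1 <= 4.
Proof.
move=> Qpos Q2.
suff : \sum_(i < k) ((Q i)%:R : R)^-1 + 2 / (Q k)%:R + 2 / (Q k.+1)%:R <= 4.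
  have : 0 <= 2 / (Q k)%:R + 2 / (Q k.+1)%:R :> R by rewrite addr_ge0 // divr_ge0.
  lra.
elim: k => [|k IH].
  rewrite big_ord0 add0r.
  have h (i : nat) : 2 / (Q i)%:R <= 2 :> R.
    by rewrite ler_pdivrMr ?ltr0n // ler_pMr // ler1n.
  by have := h 0%N; have := h 1%N; lra.
rewrite big_ord_recr /=.
have : 2 / (Q k.+2)%:R <= (Q k)%:R^-1 :> R.
  rewrite ler_pdivrMr ?ltr0n // mulrC ler_pdivlMr ?ltr0n //.
  by rewrite -natrM ler_nat.
lra.
Qed.

(** The pointwise bound on x is only for the boundary term of the summation by
parts; the constant 5 is 4 from the sum of the inverse denominators plus 1 from
that term. *)
Lemma weighted_sum_bound (R : realType) (x : nat -> R) (Q : nat -> nat)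
    (N : nat) (V L : R) :
  Q 0%N = 1%N -> (forall i, (0 < Q i)%N) -> (forall i, (Q i <= Q i.+1)%N) ->
  (forall i, (2 * Q i <= Q i.+2)%N) ->
  0 <= V -> 0 <= L ->
  (forall i, ln ((Q i.+1)%:R / (Q i)%:R) <= L) ->
  (forall j s, (j < N)%N -> `|\sum_(i < Q j) x (s + i)%N| <= V) ->
  (forall r, `|x r| <= V) ->
  `|\sum_(i < (Q N).-1) x i.+1 / i.+1%:R| <= 5 * V * (1 + L).
Proof.
move=> Q01 Qpos QS Q2 V0 L0 hL hV hx.
rewrite abel_harmonic prednK //.
apply: le_trans (ler_normD _ _) _.
have -> : 5 * V * (1 + L) = V * (4 * (1 + L)) + V * (1 + L) by ring.
apply: lerD.
  apply: le_trans (ler_norm_sum _ _ _) _.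
  under eq_bigr do rewrite normrM normfV [`|_ * _%:R|]ger0_norm ?mulr_ge0 //.
  have := weighted_sum_invariant _ _ _ _ _ Q01 Qpos QS V0 hV N (leqnn N).
  have : 0 <= V * ratio_sum R Q N / (Q N)%:R.
    by rewrite divr_ge0 // mulr_ge0 // ratio_sum_ge0.
  move=> h0 h1.
  apply: (@le_trans _ _
      (V * \sum_(i < N) (1 + ln ((Q i.+1)%:R / (Q i)%:R)) / (Q i)%:R)); first lra.
  rewrite ler_wpM2l // [4 * _]mulrC.
  apply: (@le_trans _ _ ((1 + L) * \sum_(i < N) ((Q i)%:R : R)^-1)).
    rewrite mulr_sumr; apply: ler_sum => i _.
    by rewrite ler_wpM2r ?invr_ge0 // lerD2l.
  by rewrite ler_wpM2l ?sum_inv_denominators //; lra.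
rewrite normrM normfV [`|_%:R|]ger0_norm //.
rewrite ler_pdivrMr ?ltr0n //.
apply: le_trans (ler_norm_sum _ _ _) _.
apply: (@le_trans _ _ (\sum_(i < (Q N).-1) V)); first by apply: ler_sum.
rewrite sumr_const card_ord -[V *+ _]mulr_natr -[V * _ * _]mulrA.
rewrite ler_wpM2l //.
have : (Q N).-1%:R <= (Q N)%:R :> R by rewrite ler_nat leq_pred.
have : 0 <= (Q N).-1%:R :> R by []; clear -L0; nra.
Qed.

(** * The cotangent near its poles *)

Lemma sin_lip (R : realType) (u v : R) : `|sin u - sin v| <= `|u - v|.
Proof.
wlog uv : u v / v <= u => [H|].
  by have [/H//|/ltW/H] := leP v u; rewrite distrC (distrC u).
have [c _ ->] := MVT_segment uv (fun x _ => is_derive_sin x)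
  (continuous_subspaceT (@continuous_sin R)).
by rewrite normrM ler_piMl ?cos_max.
Qed.

Lemma cos_lip (R : realType) (u v : R) : `|cos u - cos v| <= `|u - v|.
Proof.
rewrite -!sinDpihalf; apply: le_trans (sin_lip _ _ _) _.
by rewrite le_eqVlt; apply/orP; left; apply/eqP; congr `|_|; ring.
Qed.

Lemma sin_le_id (R : realType) (y : R) : 0 <= y -> sin y <= y.
Proof.
move=> y0; have := sin_lip R y 0; rewrite sin0 !subr0 [`|y|]ger0_norm //.
by apply: le_trans; exact: ler_norm.
Qed.

Lemma mul_cos_le_sin (R : realType) (y : R) : 0 <= y <= pi / 2 ->
  y * cos y <= sin y.
Proof.
move=> /andP[y0 y1]; have pi0 := pi_gt0 R.
have [c] := MVT_segment y0 (fun x _ => is_derive_sin x)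
  (continuous_subspaceT (@continuous_sin R)).
rewrite sin0 !subr0 in_itv /= => /andP[c0 cy] ->.
rewrite mulrC ler_wpM2r // leNgt ltr_cos ?in_itv /= -?leNgt //; lra.
Qed.

(** Halving the angle, sin y = 2 sin(y/2) cos(y/2) >= y cos(y/2)^2
= y (1 + cos y) / 2. *)
Lemma half_le_sin (R : realType) (y : R) : 0 <= y <= pi / 2 -> y / 2 <= sin y.
Proof.
move=> hy; have hy2 : 0 <= y / 2 <= pi / 2 by lra.
have := mul_cos_le_sin R (y / 2) hy2.
have c0 : 0 <= cos y by apply: cos_ge0_pihalf; have := pi_gt0 R; lra.
have c1 : 0 <= cos (y / 2) by apply: cos_ge0_pihalf; have := pi_gt0 R; lra.
have e2 : y = (y / 2) *+ 2 by rewrite mulr2n; lra.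
have := cos_mulr2n (y / 2); have := sin_mulr2n (y / 2); rewrite -e2.

move: c0 c1; rewrite expr2 ![(_ * _) *+ 2]mulr2n; set c := cos (y / 2); set s := sin (y / 2).
move=> c0 c1 -> e1 h; rewrite e1 in c0.
have : c * (y / 2 * c) <= c * s by rewrite ler_wpM2l.
have : 0 <= y * (c * c + c * c - 1) by rewrite mulr_ge0 //; lra.
lra.
Qed.

Lemma one_sub_cos_le (R : realType) (y : R) : 0 <= y -> 1 - cos y <= y ^+ 2 / 2.
Proof.
move=> y0.
have e2 : y = (y / 2) *+ 2 by rewrite mulr2n; lra.
have := cos_mulr2n (y / 2); rewrite -e2 => ->.
rewrite cos2sin2; have : `|sin (y / 2)| <= y / 2.
  have := sin_lip R (y / 2) 0; rewrite sin0 !subr0 [`|y / 2|]ger0_norm //; lra.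
rewrite -ler_sqr ?nnegrE //; last by lra.
rewrite real_normK ?num_real // [(1 - _) *+ 2]mulr2n !expr2; lra.
Qed.

Lemma cot_near_inv (R : realType) (y : R) : 0 < y <= pi / 2 ->
  0 <= y^-1 - cos y / sin y <= y.
Proof.
move=> /andP[y0 y1].
have hy : 0 <= y <= pi / 2 by lra.
have s1 := half_le_sin R y hy; have s2 := mul_cos_le_sin R y hy.
have s3 := sin_le_id R y (ltW y0); have s4 := one_sub_cos_le R y (ltW y0).
have s0 : 0 < sin y by lra.
have -> : y^-1 - cos y / sin y = (sin y - y * cos y) / (y * sin y).
  by field; rewrite !gt_eqF.
rewrite divr_ge0 ?subr_ge0 //= ?mulr_ge0 ?(ltW y0) ?(ltW s0) //.
rewrite ler_pdivrMr ?mulr_gt0 //.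
have : y * (1 - cos y) <= y * (y ^+ 2 / 2) by rewrite ler_wpM2l // ltW.
have : y ^+ 2 * (y / 2) <= y ^+ 2 * sin y by rewrite ler_wpM2l ?sqr_ge0.
rewrite !expr2; lra.
Qed.

Definition cot (R : realType) (x : R) : R := cos x / sin x.

(** On (0, 1/2] only the pole at 0 matters and the other fraction is at most 1;
the reflection t -> 1 - t changes all signs and gives the other half. *)
Lemma cot_two_poles (R : realType) (t : R) : 0 < t < 1 ->
  `|cot R (pi * t) - ((pi * t)^-1 - (pi * (1 - t))^-1)| <= 2.
Proof.
have pi0 := pi_gt0 R; have pi2 := pi_ge2 R.
have pi4 : pi / 2 < 2 :> R by case/andP: (pihalf_02 R).
wlog t2 : t / t <= 1 / 2 => [H|] /andP[t0 t1].
  have [t2|t2] := leP t (1 / 2); first by apply: H => //; lra.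
  have odd : cot R (pi * (1 - t)) = - cot R (pi * t).
    rewrite /cot mulrBr mulr1 cosB sinB cospi sinpi !mul0r addr0 sub0r !mulN1r.
    by rewrite opprK mulNr.
  have := H (1 - t); rewrite odd [1 - (1 - t)](_ : _ = t); last by ring.
  rewrite -normrN [X in `|X|](_ : _ =
    cot R (pi * t) - ((pi * t)^-1 - (pi * (1 - t))^-1)); last by ring.
  by apply; lra.
have y0 : 0 < pi * t by rewrite mulr_gt0.
have /andP[c1 c2] : 0 <= (pi * t)^-1 - cos (pi * t) / sin (pi * t) <= pi * t.
  by apply: cot_near_inv; rewrite y0 /=; nra.
have d0 : 1 <= pi * (1 - t) by clear -pi2 t2; nra.
have d1 : 0 <= (pi * (1 - t))^-1 <= 1.
  by rewrite invr_ge0 invf_le1 ?d0 ?andbT //; lra.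
have d2 : pi * t <= 2 by nra.
rewrite /cot ler_norml; lra.
Qed.

(** * Cotangent sums over a rational rotation *)

(** Reflecting the part with the pole at 1 moves it to 0 and replaces y by
1 - y; the number of points is n + 1, the point 0 being left out. *)
Lemma cot_sum_reflect (R : realType) (F : R -> R) (y : nat -> R) (n : nat) :
  (forall i, (i < n)%N -> y (n - i)%N = 1 - y i.+1) ->
  \sum_(i < n) F (y i.+1) * ((pi * (i.+1%:R / n.+1%:R))^-1 -
                             (pi * (1 - i.+1%:R / n.+1%:R))^-1) =
  n.+1%:R / pi * \sum_(i < n) (F (y i.+1) - F (1 - y i.+1)) / i.+1%:R.
Proof.
move=> ysym; move: (@pi R) (pi_gt0 R) => c c0.
under eq_bigr do rewrite mulrBr; under [in RHS]eq_bigr do rewrite mulrBl.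
rewrite !sumrB mulrBr !mulr_sumr; congr (_ - _).
  apply: eq_bigr => i _.
  by rewrite invfM invf_div; field; rewrite (gt_eqF c0) ?nat1r ?natr1 ?pnatr_eq0.
rewrite (reindex_inj rev_ord_inj) /=; apply: eq_bigr => i _.
have -> : (n - i.+1).+1 = (n - i)%N by rewrite subnSK.
rewrite ysym //.
have ->: 1 - (n - i)%:R / n.+1%:R = i.+1%:R / n.+1%:R :> R.
  by rewrite natrB 1?ltnW // -!natr1; field; rewrite natr1 pnatr_eq0.
by rewrite invfM invf_div; field; rewrite (gt_eqF c0) ?nat1r ?natr1 ?pnatr_eq0.
Qed.

(** After the reflection the sum has coefficients h(y) = F(y) - F(1 - y), for
which denjoy_koksma gives the block bound V = 12 B.  The constant is
12 * 5 / 2 = 30 from weighted_sum_bound and pi >= 2, plus 2 from the bounded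
part of the cotangent. *)
Lemma cot_sum_bound (R : realType) (F : R -> R) (B L beta : R) (n N : nat)
    (Q : nat -> nat) (P : nat -> int) :
  (forall y : R, 0 <= y <= 1 -> `|F y| <= B) ->
  (forall x y : R, 0 <= x <= 1 -> 0 <= y <= 1 -> `|F x - F y| <= B * `|x - y|) ->
  (forall i, (i < n)%N ->
     frac R ((n - i)%:R * beta) = 1 - frac R (i.+1%:R * beta)) ->
  Q 0%N = 1%N -> (forall i, (0 < Q i)%N) -> (forall i, (Q i <= Q i.+1)%N) ->
  (forall i, (2 * Q i <= Q i.+2)%N) ->
  0 <= L -> (forall i, ln ((Q i.+1)%:R / (Q i)%:R) <= L) ->
  Q N = n.+1 ->
  (forall j, (j < N)%N -> coprimez (P j) (Q j)) ->
  (forall j, (j < N)%N -> `|(Q j)%:R * beta - (P j)%:~R| <= (Q j)%:R^-1) ->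
  `|\sum_(i < n) F (frac R (i.+1%:R * beta)) *
        cot R (pi * (i.+1%:R / n.+1%:R))| <= 32 * B * n.+1%:R * (1 + L).
Proof.
move=> hB hLip ysym Q01 Qpos QS Q2 L0 hL QN cop happ.
have B0 : 0 <= B by apply: le_trans (hB 0 _); rewrite ?lexx ?ler01.
have pi0 := pi_gt0 R; have pi2 := pi_ge2 R.
pose y r := frac R (r%:R * beta).
have y01 r : 0 <= y r <= 1 by have := frac_itv R (r%:R * beta); rewrite /y; lra.
pose h x := F x - F (1 - x).
have hhB (x : R) : 0 <= x <= 1 -> `|h x| <= 2 * B.
  move=> hx; apply: le_trans (ler_normB _ _) _.
  have := hB x hx; have := hB (1 - x); lra.
have hhL (x z : R) : 0 <= x <= 1 -> 0 <= z <= 1 ->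
    `|h x - h z| <= 2 * B * `|x - z|.
  move=> hx hz.
  have -> : h x - h z = (F x - F z) - (F (1 - x) - F (1 - z)) by rewrite /h; ring.
  apply: le_trans (ler_normB _ _) _.
  have := hLip x z hx hz; have := hLip (1 - x) (1 - z).
  have -> : `|1 - x - (1 - z)| = `|x - z|.
    by rewrite -[RHS]normrN; congr `|_|; ring.
  by move=> h1 h2; rewrite -mulrA mulr_natl mulr2n; apply: lerD => //; apply: h1; lra.
have hodd x : h (1 - x) = - h x.
  by rewrite /h [1 - (1 - x)](_ : _ = x); ring.
have dk j s : (j < N)%N -> `|\sum_(i < Q j) h (y (s + i)%N)| <= 12 * B.
  move=> jN; have -> : 12 * B = 6 * (2 * B) by ring.
  exact: (denjoy_koksma _ _ _ _ _ _ hhB hhL hodd (Qpos j) (cop j jN) (happ j jN)).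
have hyB r : `|h (y r)| <= 12 * B by apply: le_trans (hhB _ (y01 r)) _; lra.
have V0 : 0 <= 12 * B by lra.
have := weighted_sum_bound _ _ _ N _ _ Q01 Qpos QS Q2 V0 L0 hL dk hyB.
rewrite QN /= => main.
pose d (i : nat) : R := (pi * (i.+1%:R / n.+1%:R))^-1 -
                       (pi * (1 - i.+1%:R / n.+1%:R))^-1.
have -> : \sum_(i < n) F (y i.+1) * cot R (pi * (i.+1%:R / n.+1%:R)) =
  \sum_(i < n) F (y i.+1) * d i +
  \sum_(i < n) F (y i.+1) * (cot R (pi * (i.+1%:R / n.+1%:R)) - d i).
  by rewrite -big_split /=; apply: eq_bigr => i _; ring.
rewrite /d cot_sum_reflect // -/d.
have n0 : 0 <= n.+1%:R :> R by [].
apply: le_trans (ler_normD _ _) _.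
apply: (@le_trans _ _ (n.+1%:R / 2 * (5 * (12 * B) * (1 + L)) + n.+1%:R * (2 * B))).
  apply: lerD.
    rewrite normrM ler_pM // ger0_norm ?divr_ge0 ?(ltW pi0) //.
    by rewrite ler_wpM2l // lef_pV2 ?posrE.
  apply: le_trans (ler_norm_sum _ _ _) _.
  apply: (@le_trans _ _ (\sum_(i < n) (2 * B))).
    apply: ler_sum => i _; rewrite normrM mulrC.
    rewrite ler_pM // ?hB //.
    apply: cot_two_poles; rewrite divr_gt0 ?ltr0n //=.
    by rewrite ltr_pdivrMr ?ltr0n // mul1r ltr_nat ltnS.
  rewrite sumr_const card_ord -[_ *+ n]mulr_natl ler_wpM2r ?mulr_ge0 //.
  by rewrite ler_nat.
have : 0 <= n.+1%:R * B * L by rewrite !mulr_ge0.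
lra.
Qed.

(** * Geometric sums twisted by a root of unity *)

Lemma norm_complex_le (R : realType) (z : R[i]) :
  `|z| <= (`|complex.Re z| + `|complex.Im z|)%:C.
Proof.
rewrite normc_def lecR -[X in _ <= X]ger0_norm ?addr_ge0 // -sqrtr_sqr.
rewrite ler_wsqrtr // sqrrD !real_normK ?num_real // -addrA lerD2l lerDr.
by rewrite mulrn_wge0 // mulr_ge0.
Qed.

Lemma sum_complex (R : realType) (n : nat) (a b : nat -> R) :
  \sum_(i < n) (a i +i* b i) = (\sum_(i < n) a i) +i* (\sum_(i < n) b i).
Proof.
elim: n => [|n IH]; first by rewrite !big_ord0.
by rewrite !big_ord_recr /= IH.
Qed.

Lemma eD (R : realType) (x y : R) : e (x + y) = e x * e y.
Proof.
rewrite /e mulrDr cosD sinD; apply/eqP; rewrite eq_complex /=.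
by apply/andP; split; apply/eqP; ring.
Qed.

Lemma e0 (R : realType) : e 0 = 1 :> R[i].
Proof. by rewrite /e mulr0 cos0 sin0. Qed.

Lemma e_natM (R : realType) (x : R) (k : nat) : e (k%:R * x) = e x ^+ k.
Proof.
elim: k => [|k IH]; first by rewrite mul0r e0.
by rewrite -natr1 mulrDl mul1r eD IH exprSr.
Qed.

Lemma e_nat (R : realType) (k : nat) : e (k%:R : R) = 1.
Proof.
have e1 : e (1 : R) = 1 by rewrite /e mulr1 mulr_natl cos2pi sin2pi.
by rewrite -[k%:R]mulr1 e_natM e1 expr1n.
Qed.

Lemma e_int (R : realType) (z : int) : e (z%:~R : R) = 1.
Proof.
case: z => k; first exact: e_nat.
have := eD _ (k.+1%:R : R) (- k.+1%:R); rewrite subrr e0 e_nat mul1r => ->.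
by rewrite NegzE mulrNz.
Qed.

Lemma norm_e (R : realType) (x : R) : `|e x| = 1.
Proof. by rewrite normc_def /= cos2Dsin2 sqrtr1. Qed.

Lemma norm_e_sub1_le (R : realType) (x : R) : `|e x - 1| <= (16 * `|x|)%:C.
Proof.
apply: le_trans (norm_complex_le _ _) _; rewrite lecR /= subr0.
have pi4 : pi / 2 < 2 :> R by case/andP: (pihalf_02 R).
have h : `|2 * pi * x| <= 8 * `|x|.
  by rewrite normrM ler_wpM2r // ger0_norm ?mulr_ge0 ?pi_ge0 //; lra.
have := cos_lip R (2 * pi * x) 0; have := sin_lip R (2 * pi * x) 0.
rewrite cos0 sin0 !subr0; lra.
Qed.

Lemma inv_e_sub1 (R : realType) (t : R) : 0 < t < 1 ->
  (e t - 1)^-1 = (- 2^-1) +i* (- (cot R (pi * t) / 2)).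
Proof.
move=> /andP[t0 t1]; have pi0 := pi_gt0 R.
have s0 : 0 < sin (pi * t).
  by apply: sin_gt0_pi; rewrite mulr_gt0 //= gtr_pMr.
have E : (e t - 1) * ((- 2^-1) +i* (- (cot R (pi * t) / 2))) = 1.
  rewrite /e /cot -mulrA mulr_natl cos_mulr2n sin_mulr2n.
  have := cos2Dsin2 (pi * t); move: s0.
  move: (cos (pi * t)) (sin (pi * t)) => c s s0 cs.
  apply/eqP; rewrite eq_complex /=; apply/andP; split; apply/eqP.
    have -> : c ^+ 2 = 1 - s ^+ 2 by rewrite -cs; ring.
    transitivity (c ^+ 2 + s ^+ 2) => //.
    by field; rewrite gt_eqF.
  have -> : c ^+ 2 = 1 - s ^+ 2 by rewrite -cs; ring.
  by field; rewrite gt_eqF.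
have X0 : e t - 1 != 0.
  by apply/eqP => X0; move: E; rewrite X0 mul0r => /eqP; rewrite eq_sym oner_eq0.
by apply: (mulfI X0); rewrite mulfV // E.
Qed.

Lemma norm_inv_e_sub1_le (R : realType) (t : R) : 0 < t < 1 ->
  `|(e t - 1)^-1| <= (2 * (t^-1 + (1 - t)^-1))%:C.
Proof.
move=> ht; have := cot_two_poles R t ht; rewrite inv_e_sub1 //.
have pi0 := pi_gt0 R; have pi2 := pi_ge2 R.
move: ht => /andP[t0 t1] hc.
apply: le_trans (norm_complex_le _ _) _; rewrite lecR /= !normrN.
rewrite [`|2^-1|]ger0_norm // normrM [`|2^-1|]ger0_norm //.
have i1 : 1 <= t^-1 by rewrite invf_ge1 // ltW.
have i2 : 1 <= (1 - t)^-1 by rewrite invf_ge1; lra.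
have b (x : R) : 0 < x -> 0 <= (pi * x)^-1 <= x^-1.
  move=> x0; rewrite invr_ge0 mulr_ge0 ?(ltW x0) ?(ltW pi0) //=.
  by rewrite lef_pV2 ?posrE ?mulr_gt0 // ler_peMl ?(ltW x0) //; lra.
have := b t t0; have := b (1 - t); move: hc; rewrite ler_norml => hc b1 b2.
have {}b1 := b1 ltac:(lra).
have : `|cot R (pi * t)| <= 2 + t^-1 + (1 - t)^-1 by rewrite ler_norml; lra.
lra.
Qed.

(** With Y = X Z, the sum is (Y^q - 1) / (Y - 1), and Y^q = Z^q.  Writing
Y - 1 = (X - 1) + (Z - 1) X isolates the factor X - 1, which is the one that
depends on the residue class alone. *)
Lemma twisted_geometric_sum (F : fieldType) (X Z : F) (q : nat) :
  X ^+ q = 1 ->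
  (X - 1) * \sum_(i < q) (X * Z) ^+ i =
  (Z ^+ q - 1) - (Z - 1) * X * \sum_(i < q) (X * Z) ^+ i.
Proof.
move=> Xq; have := subrX1 (X * Z) q; rewrite exprMn Xq mul1r => ->; ring.
Qed.

(** Let G be the sum.  In twisted_geometric_sum the last term is at most
|Z - 1| q = O(1), so |(X - 1) G| = O(1) even where X Z is very close to 1.
Feeding this back into the same identity, the error is
|Z - 1| |(X - 1) G| / |X - 1|^2.  Here |Z - 1| <= 16 / q and
|(X - 1) G| <= 2 + 16, whence 288 = 16 * 18. *)
Lemma inner_sum_approx (R : realType) (q : nat) (t x : R) :
  (0 < q)%N -> 0 < t < 1 -> e (q%:R * t) = 1 -> `|x| <= q%:R^-1 ->
  `|\sum_(i < q) (e t * e x) ^+ i - (e (q%:R * x) - 1) * (e t - 1)^-1| <=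
  (288 / q%:R * (2 * (t^-1 + (1 - t)^-1)) ^+ 2)%:C.
Proof.
move=> q0 ht eqt hx.
have q0' : 0 < q%:R :> R by rewrite ltr0n.
set G := \sum_(i < q) _.
have X0 : e t - 1 != 0.
  apply/eqP => X0; have := inv_e_sub1 R t ht; rewrite X0 invr0 => /eqP.
  by rewrite eq_complex /= eq_sym oppr_eq0 invr_eq0 pnatr_eq0.
have key : (e t - 1) * G = (e (q%:R * x) - 1) - (e x - 1) * e t * G.
  by rewrite e_natM twisted_geometric_sum // -e_natM.
have normC (a : R) : 0 <= a -> `|a%:C| = a%:C :> R[i] by move=> a0; rewrite ger0_norm // ler0c.
have hz : `|e x - 1| <= (16 / q%:R)%:C.
  by apply: le_trans (norm_e_sub1_le _ _) _; rewrite lecR ler_wpM2l.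
have hG : `|G| <= q%:R%:C.
  apply: le_trans (ler_norm_sum _ _ _) _.
  under eq_bigr do rewrite normrX normrM !norm_e mulr1 expr1n.
  by rewrite sumr_const card_ord rmorph_nat.
have hw : `|e (q%:R * x) - 1| <= 2%:C.
  by apply: le_trans (ler_normB _ _) _; rewrite norm_e normr1 rmorph_nat.
have hXG : `|(e t - 1) * G| <= 18%:C.
  rewrite key; apply: le_trans (ler_normB _ _) _.
  rewrite !normrM norm_e mulr1.
  apply: le_trans (lerD hw (ler_pM _ _ hz hG)) _ => //.
  by rewrite -rmorphM -rmorphD lecR divfK ?gt_eqF //; lra.
have -> : G - (e (q%:R * x) - 1) * (e t - 1)^-1 =
  - ((e x - 1) * e t * ((e t - 1) * G) * (e t - 1)^-1 ^+ 2).
  have -> : e (q%:R * x) - 1 = (e t - 1) * G + (e x - 1) * e t * G by rewrite key; ring.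
  by field.
set Y := (e t - 1) * G in hXG *.
rewrite normrN normrM normrX 2!normrM norm_e mulr1.
have hI := norm_inv_e_sub1_le R t ht.
have -> : 288 / q%:R = 16 / q%:R * 18 :> R by field; rewrite gt_eqF.
rewrite 2!rmorphM rmorphXn.
apply: ler_pM => //.
- exact: ler_pM.
- by rewrite lerXn2r ?nnegrE // (le_trans _ hI).
Qed.

Lemma sum_inv_sqr_le (R : realType) (n : nat) :
  \sum_(i < n) (i.+1%:R ^+ 2 : R)^-1 <= 2.
Proof.
case: n => [|n]; first by rewrite big_ord0.
suff : \sum_(i < n.+1) (i.+1%:R ^+ 2 : R)^-1 <= 2 - n.+1%:R^-1.
  by move=> h; apply: le_trans h _; rewrite gerBl.
elim: n => [|n IH]; first by rewrite big_ord1 expr1n; lra.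
rewrite big_ord_recr /=; apply: le_trans (lerD IH (lexx _)) _.
have n0 : 0 < n.+1%:R :> R by [].
have -> : n.+2%:R = n.+1%:R + 1 :> R by rewrite natr1.
set x := n.+1%:R in n0 *.
have E : (x * (x + 1))^-1 = x^-1 - (x + 1)^-1 by field; rewrite !gt_eqF //; lra.
have : ((x + 1) ^+ 2)^-1 <= (x * (x + 1))^-1.
  by rewrite lef_pV2 ?posrE ?mulr_gt0 ?exprn_gt0 //; [nra | lra..].
rewrite E; move: (x^-1) (x + 1)^-1 ((x + 1) ^+ 2)^-1 => a b c; lra.
Qed.

Lemma sum_inv_dist_le (R : realType) (n : nat) :
  \sum_(i < n) (2 * ((i.+1%:R / n.+1%:R)^-1 + (1 - i.+1%:R / n.+1%:R)^-1)) ^+ 2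
  <= 32 * n.+1%:R ^+ 2 :> R.
Proof.
pose f (i : nat) : R := (i.+1%:R ^+ 2)^-1.
have fE (i : 'I_n) : (2 * ((i.+1%:R / n.+1%:R)^-1 + (1 - i.+1%:R / n.+1%:R)^-1)) ^+ 2
   <= 8 * n.+1%:R ^+ 2 * (f i + f (n - i.+1)%N).
  have -> : 1 - i.+1%:R / n.+1%:R = (n - i.+1).+1%:R / n.+1%:R :> R.
    rewrite subnSK // natrB 1?ltnW // -!natr1; field.
    by rewrite natr1 pnatr_eq0.
  have gen (x z q : R) : (2 * (q * x + q * z)) ^+ 2 <= 8 * q ^+ 2 * (x ^+ 2 + z ^+ 2).
    rewrite -subr_ge0 [X in 0 <= X](_ : _ = 4 * (q * (x - z)) ^+ 2); last by ring.
    by rewrite mulr_ge0 ?sqr_ge0.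
  by rewrite !invf_div /f -!exprVn; exact: gen.
apply: (@le_trans _ _ (\sum_(i < n) 8 * n.+1%:R ^+ 2 * (f i + f (n - i.+1)%N))).
  exact: ler_sum.
rewrite -mulr_sumr big_split /=.
have -> : \sum_(i < n) f (n - i.+1)%N = \sum_(i < n) f i.
  by rewrite [RHS](reindex_inj rev_ord_inj).
have := sum_inv_sqr_le R n; rewrite -/f => h.
have q2 : 0 <= n.+1%:R ^+ 2 :> R by rewrite sqr_ge0.
have : n.+1%:R ^+ 2 * (\sum_(i < n) f i) <= n.+1%:R ^+ 2 * 2 by rewrite ler_wpM2l.
lra.
Qed.

(** * The double sum near a rational point *)

Lemma frac_rational (R : realType) (u : int) (q r : nat) : (0 < q)%N ->
  frac R (r%:R * (u%:~R / q%:R)) = `|((0 + u * r%:Z) %% q)%Z|%N%:R / q%:R.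
Proof.
move=> q0; have q0' : 0 < q%:R :> R by rewrite ltr0n.
set m := `|_|%N.
have mE : (m%:Z = (u * r%:Z) %% q)%Z by rewrite /m add0r gez0_abs // modz_ge0 // -lt0n.
apply: (frac_eq _ _ ((u * r%:Z) %/ q)%Z).
  by rewrite divr_ge0 //= ltr_pdivrMr // mul1r ltr_nat -ltz_nat mE ltz_pmod.
have /(congr1 (fun z : int => z%:~R : R)) /= := divz_eq (u * r%:Z) q.
rewrite -mE rmorphD !rmorphM /= -!pmulrn => E.
by rewrite mulrA [_ * u%:~R]mulrC E; field; rewrite gt_eqF.
Qed.

Lemma frac_rational_gt0 (R : realType) (u : int) (q r : nat) :
  coprimez u q -> (0 < r < q)%N -> 0 < frac R (r%:R * (u%:~R / q%:R)).
Proof.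
move=> cop /andP[r0 rq]; have q0 : (0 < q)%N by apply: ltn_trans rq.
rewrite frac_rational // divr_gt0 ?ltr0n // lt0n absz_eq0 add0r.
apply/negP => /eqP/dvdz_mod0P; rewrite Gauss_dvdzr 1?coprimez_sym //.
by rewrite dvdzE /= => /dvdn_leq; lia.
Qed.

Lemma frac_rational_sym (R : realType) (u : int) (n i : nat) :
  coprimez u n.+1 -> (i < n)%N ->
  frac R ((n - i)%:R * (u%:~R / n.+1%:R)) =
  1 - frac R (i.+1%:R * (u%:~R / n.+1%:R)).
Proof.
move=> cop ni; set x := i.+1%:R * _.
have := frac_rational_gt0 R u n.+1 i.+1 cop ltac:(lia).
rewrite -/x => f0; have /andP[_ f1] := frac_itv R x.
apply: (frac_eq _ _ (u - 1 - Num.floor x)); first by lra.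
rewrite !rmorphB /= /frac.
have -> : (n - i)%:R * (u%:~R / n.+1%:R) = u%:~R - x.
  rewrite /x natrB 1?ltnW // -!natr1; field.
  by rewrite natr1 pnatr_eq0.
by ring.
Qed.

(** Here F1 + i F2 stands for the numerator e(q m delta) - 1 and
-1/2 - (i/2) k for the reciprocal of e(t) - 1. *)
Lemma main_term_bound (R : realType) (n : nat) (F1 F2 k : nat -> R) (B S : R) :
  (forall i, (i < n)%N -> `|F1 i| <= B) -> (forall i, (i < n)%N -> `|F2 i| <= B) ->
  `|\sum_(i < n) F1 i * k i| <= S -> `|\sum_(i < n) F2 i * k i| <= S ->
  `|\sum_(i < n) ((F1 i +i* F2 i) * ((- 2^-1) +i* (- (k i / 2))))| <=
  (n%:R * B + S)%:C.
Proof.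
move=> h1 h2 s1 s2.
have triv (F : nat -> R) : (forall i, (i < n)%N -> `|F i| <= B) ->
    `|\sum_(i < n) F i| <= n%:R * B.
  move=> h; apply: le_trans (ler_norm_sum _ _ _) _.
  rewrite mulr_natl -[X in _ *+ X]card_ord -sumr_const.
  by apply: ler_sum => i _; apply: h.
have -> : \sum_(i < n) ((F1 i +i* F2 i) * ((- 2^-1) +i* (- (k i / 2)))) =
  \sum_(i < n) ((- 2^-1 * F1 i + 2^-1 * (F2 i * k i)) +i*
               (- 2^-1 * F2 i - 2^-1 * (F1 i * k i))).
  apply: eq_bigr => i _; apply/eqP; rewrite eq_complex /=.
  by apply/andP; split; apply/eqP; ring.
rewrite (sum_complex R n (fun i => - 2^-1 * F1 i + 2^-1 * (F2 i * k i))
                         (fun i => - 2^-1 * F2 i - 2^-1 * (F1 i * k i))).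
apply: le_trans (norm_complex_le _ _) _; rewrite lecR /=.
rewrite big_split sumrB /= -!mulr_sumr.
have := triv F1 h1; have := triv F2 h2; move: s1 s2.
rewrite !ler_norml.
set a := \sum_(i < n) F1 i; set b := \sum_(i < n) F2 i.
set c := \sum_(i < n) (F1 i * k i); set d := \sum_(i < n) (F2 i * k i).
move=> s1 s2 t1 t2.
have : `|- 2^-1 * a + 2^-1 * d| <= (n%:R * B + S) / 2 by rewrite ler_norml; lra.
have : `|- 2^-1 * b - 2^-1 * c| <= (n%:R * B + S) / 2 by rewrite ler_norml; lra.
lra.
Qed.

(** The inverse u of p modulo n + 1 reorders the outer sum; A plays the role of
the next partial quotient and Q_0, ..., Q_N are the denominators of good
approximations of u / (n + 1).  The constant 9225 is 1 from m = 0, 8 from the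
real part -1/2 of the reciprocal of e(t) - 1, and 9216 = 288 * 32 from the
approximation of the inner sums; 256 = 32 * 8 where 8 / A is the Lipschitz
constant of the numerator. *)
Lemma T_bound (R : realType) (alpha delta A L : R) (p u v : int) (n N : nat)
    (Q : nat -> nat) (P : nat -> int) :
  alpha = p%:~R / n.+1%:R + delta -> 1 <= A ->
  `|delta| <= (A * n.+1%:R ^+ 2)^-1 ->
  u * p = 1 + n.+1%:Z * v ->
  Q 0%N = 1%N -> (forall i, (0 < Q i)%N) -> (forall i, (Q i <= Q i.+1)%N) ->
  (forall i, (2 * Q i <= Q i.+2)%N) ->
  0 <= L -> (forall i, ln ((Q i.+1)%:R / (Q i)%:R) <= L) ->
  Q N = n.+1 ->
  (forall j, (j < N)%N -> coprimez (P j) (Q j)) ->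
  (forall j, (j < N)%N ->
     `|(Q j)%:R * (u%:~R / n.+1%:R) - (P j)%:~R| <= (Q j)%:R^-1 :> R) ->
  `|T alpha n.+1| <= (9225 + 256 * (1 + L) / A)%:C.
Proof.
move=> halpha A1 hdelta hup Q01 Qpos QS Q2 L0 hL QN cop happ.
have copu : coprimez u n.+1.
  by apply/coprimezP; exists (p, - v); rewrite /= mulrC hup; ring.
set q := n.+1 in hup copu *.
have q0 : 0 < q%:R :> R by rewrite ltr0n.
have A0 : 0 < A by lra.
pose m (r : nat) := `|((0 + u * r%:Z) %% q)%Z|%N.
pose beta : R := u%:~R / q%:R.
have yE r : frac R (r%:R * beta) = (m r)%:R / q%:R by exact: frac_rational.
have mE r : ((m r)%:Z = (u * r%:Z) %% q)%Z.
  by rewrite /m add0r gez0_abs // modz_ge0.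
have mq r : (m r < q)%N by rewrite -ltz_nat mE ltz_pmod.
pose G (k : nat) : R[i] := \sum_(i < q) (e (k%:R * alpha)) ^+ i.
have TE : T alpha q = q%:R^-1 * \sum_(r < q) G (m r).
  rewrite /T big_mkord (sum_affine_mod _ G) // /G; congr (_ * _).
  apply: eq_bigr => k _; rewrite big_mkord; apply: eq_bigr => i _.
  by rewrite -mulrA e_natM.
(* Since m r p = r modulo q, the rational part of the phase is r / q. *)
have phase r : e ((m r)%:R * alpha) = e (r%:R / q%:R) * e ((m r)%:R * delta).
  rewrite halpha mulrDr eD; congr (_ * _).
  have /(congr1 (fun z : int => z%:~R : R)) : (m r)%:Z * p =
      r%:Z + q%:Z * (v * r%:Z - ((u * r%:Z) %/ q)%Z * p).
    have := divz_eq (u * r%:Z) q; rewrite -mE => E.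
    have -> : (m r)%:Z = u * r%:Z - (u * r%:Z %/ q)%Z * q by rewrite {1}E; ring.
    by rewrite mulrBl mulrAC hup; ring.
  set w := v * _ - _; rewrite rmorphD !rmorphM /= -!pmulrn => E.
  have -> : (m r)%:R * (p%:~R / q%:R) = r%:R / q%:R + w%:~R :> R.
    by rewrite mulrA E; field; rewrite gt_eqF.
  by rewrite eD e_int mulr1.
have G_le k : `|G k| <= (q%:R)%:C.
  apply: le_trans (ler_norm_sum _ _ _) _.
  under eq_bigr do rewrite normrX norm_e expr1n.
  by rewrite sumr_const card_ord rmorph_nat.
(* The numerator is e(eta y) - 1 with y = m r / q in [0,1]. *)
pose eta := q%:R ^+ 2 * delta.
have eta_le : `|eta| <= A^-1.
  rewrite normrM ger0_norm ?sqr_ge0 //.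
  apply: le_trans (ler_wpM2l (sqr_ge0 _) hdelta) _.
  by rewrite invfM mulrCA divff ?mulr1 // expf_neq0 // gt_eqF.
pose F1 (y : R) := cos (2 * pi * (eta * y)) - 1.
pose F2 (y : R) := sin (2 * pi * (eta * y)).
have Lip (x y : R) : `|2 * pi * (eta * x) - 2 * pi * (eta * y)| <= 8 / A * `|x - y|.
  have -> : 2 * pi * (eta * x) - 2 * pi * (eta * y) = 2 * pi * eta * (x - y) by ring.
  rewrite normrM ler_wpM2r // normrM ler_pM // ger0_norm ?mulr_ge0 ?pi_ge0 //.
  have : pi / 2 < 2 :> R by case/andP: (pihalf_02 R).
  lra.
have F1L (x y : R) : 0 <= x <= 1 -> 0 <= y <= 1 -> `|F1 x - F1 y| <= 8 / A * `|x - y|.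
  move=> _ _; rewrite /F1 opprB addrA subrK.
  exact: le_trans (cos_lip _ _ _) (Lip _ _).
have F2L (x y : R) : 0 <= x <= 1 -> 0 <= y <= 1 -> `|F2 x - F2 y| <= 8 / A * `|x - y|.
  by move=> _ _; exact: le_trans (sin_lip _ _ _) (Lip _ _).
have B0 : 0 <= 8 / A by rewrite divr_ge0 // ltW.
have bnd (F : R -> R) : F 0 = 0 -> (forall x y : R, 0 <= x <= 1 -> 0 <= y <= 1 ->
     `|F x - F y| <= 8 / A * `|x - y|) -> forall y : R, 0 <= y <= 1 -> `|F y| <= 8 / A.
  move=> F0 FL y hy; have := FL y 0 hy; rewrite F0 !subr0 lexx ler01 => /(_ isT).
  move=> h; apply: le_trans h _; rewrite ler_piMr //.
  by rewrite ger0_norm; case/andP: hy.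
have F1B := bnd F1 ltac:(by rewrite /F1 !mulr0 cos0 subrr) F1L.
have F2B := bnd F2 ltac:(by rewrite /F2 !mulr0 sin0) F2L.
have csum (F : R -> R) (hB : forall y : R, 0 <= y <= 1 -> `|F y| <= 8 / A) hF :=
  cot_sum_bound _ _ _ _ beta _ _ _ _ hB hF
   (fun i => frac_rational_sym R u n i copu) Q01 Qpos QS Q2 L0 hL QN cop happ.
have y01 r : 0 <= frac R (r%:R * beta) <= 1.
  by have := frac_itv R (r%:R * beta); lra.
have main := main_term_bound R n (fun i => F1 (frac R (i.+1%:R * beta)))
  (fun i => F2 (frac R (i.+1%:R * beta))) (fun i => cot R (pi * (i.+1%:R / n.+1%:R)))
  _ _ (fun i _ => F1B _ (y01 i.+1)) (fun i _ => F2B _ (y01 i.+1))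
  (csum F1 F1B F1L) (csum F2 F2B F2L).
pose W (i : nat) := (F1 (frac R (i.+1%:R * beta)) +i* F2 (frac R (i.+1%:R * beta))) *
  ((- 2^-1) +i* (- (cot R (pi * (i.+1%:R / n.+1%:R)) / 2))).
have err (i : 'I_n) : `|G (m i.+1) - W i| <= (288 / q%:R *
   (2 * ((i.+1%:R / q%:R)^-1 + (1 - i.+1%:R / q%:R)^-1)) ^+ 2)%:C.
  have t01 : 0 < (i.+1%:R / q%:R : R) < 1.
    by rewrite divr_gt0 ?ltr0n //= ltr_pdivrMr // mul1r ltr_nat ltnS.
  have -> : W i = (e (q%:R * ((m i.+1)%:R * delta)) - 1) * (e (i.+1%:R / q%:R) - 1)^-1.
    rewrite inv_e_sub1 // /W yE; congr (_ * _).
    have -> : q%:R * ((m i.+1)%:R * delta) = eta * ((m i.+1)%:R / q%:R).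
      by rewrite /eta; field; rewrite gt_eqF.
    by apply/eqP; rewrite eq_complex /= subr0 !eqxx.
  rewrite /G phase; apply: inner_sum_approx => //.
    by rewrite mulrC divfK ?gt_eqF // e_nat.
  rewrite normrM ger0_norm //.
  apply: (@le_trans _ _ (q%:R * (q%:R ^+ 2)^-1)); last first.
    by rewrite expr2 invfM mulrA divff ?mul1r // gt_eqF.
  rewrite ler_pM // ?ler_nat 1?ltnW //; apply: le_trans hdelta _.
  by rewrite lef_pV2 ?posrE ?mulr_gt0 ?exprn_gt0 // ler_peMl ?sqr_ge0.
rewrite TE big_ord_recl /= normrM.
have -> : `|(q%:R : R[i])^-1| = (q%:R^-1)%:C.
  by rewrite ger0_norm ?invr_ge0 // fmorphV rmorph_nat.
have tail : `|\sum_(i < n) G (m i.+1)| <=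
   (9216 * q%:R + (n%:R * (8 / A) + 32 * (8 / A) * n.+1%:R * (1 + L)))%:C.
  have -> : \sum_(i < n) G (m i.+1) = \sum_(i < n) (G (m i.+1) - W i) + \sum_(i < n) W i.
    by rewrite -big_split /=; apply: eq_bigr => i _; rewrite subrK.
  rewrite rmorphD; apply: le_trans (ler_normD _ _) _; apply: lerD => //.
  apply: le_trans (ler_norm_sum _ _ _) _.
  apply: le_trans (ler_sum _ (fun i _ => err i)) _.
  rewrite -rmorph_sum lecR -mulr_sumr.
  apply: le_trans (ler_wpM2l _ (sum_inv_dist_le R n)) _; first by rewrite divr_ge0.
  rewrite -/q le_eqVlt; apply/orP; left; apply/eqP.
  by field; rewrite gt_eqF.
apply: le_trans (ler_wpM2l _ (le_trans (ler_normD _ _) (lerD (G_le _) tail))) _.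
  by rewrite lecR.
rewrite -rmorphD -rmorphM lecR /= mulrC ler_pdivrMr //.
have A1' : A^-1 <= 1 by rewrite invf_le1.
have nq : n%:R <= q%:R :> R by rewrite ler_nat.
have : n%:R * (8 / A) <= q%:R * 8.
  by rewrite ler_pM //; lra.
rewrite -/q; lra.
Qed.

(** * The bound along the denominators of alpha *)

Lemma quotient_le_bigmax (a : nat -> int) (n i : nat) : (1 <= i <= n)%N ->
  a i <= \big[Num.max/0]_(1 <= i < n.+1) a i.
Proof.
by move=> hi; apply: le_bigmax_seq => //; rewrite mem_index_iota ltnS.
Qed.

Lemma cfden_ratio_le (a : nat -> int) (ha : positive_quotients a) (M : int) :
  (forall i, (1 <= i)%N -> a i <= M) ->
  forall j, cfden a j.+2 <= 2 * M * cfden a j.+1.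
Proof.
move=> hM j; rewrite cfdenSS.
have := cfden_leS a ha j; have := cfden_ge1 a ha j.
have := hM j.+1 isT; have := ha j.+1 isT; nia.
Qed.

Lemma cfden_double (a : nat -> int) (ha : positive_quotients a) j :
  2 * cfden a j.+1 <= cfden a j.+3.
Proof.
rewrite cfdenSS; have := cfden_leS a ha j.+1; have := cfden_ge1 a ha j.+1.
have := ha j.+2 isT; nia.
Qed.

Lemma reversed_cf_dist (R : realType) (a : nat -> int)
    (ha : positive_quotients a) (n j : nat) : (j <= n)%N ->
  `|(cfden (reversed_cf a n) j.+1)%:~R *
      ((cfden a n)%:~R / (cfden a n.+1)%:~R) -
    (cfnum (reversed_cf a n) j.+1)%:~R| <=
  (cfden (reversed_cf a n) j.+1)%:~R^-1 :> R.
Proof.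
move=> jn; have hb := reversed_cf_positive a ha n.
have q0 : 0 < (cfden a n.+1)%:~R :> R.
  by rewrite ltr0z (lt_le_trans _ (cfden_ge1 a ha n)).
have Q0 : 0 < (cfden (reversed_cf a n) j.+1)%:~R :> R.
  by rewrite ltr0z (lt_le_trans _ (cfden_ge1 _ hb j)).
have := congr1 (fun z : int => z%:~R : R) (reversed_cf_convergent a n j jn).
rewrite rmorphB !rmorphM /= rmorph_sign => E.
have -> : (cfden (reversed_cf a n) j.+1)%:~R *
      ((cfden a n)%:~R / (cfden a n.+1)%:~R) -
    (cfnum (reversed_cf a n) j.+1)%:~R =
  (-1) ^+ j * (cfden a (n - j))%:~R / (cfden a n.+1)%:~R :> R.
  by rewrite -E; field; rewrite gt_eqF.
have d0 : 0 <= (cfden a (n - j))%:~R :> R by rewrite ler0z cfden_ge0.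
rewrite !normrM normfV normrX normrN1 expr1n mul1r !ger0_norm ?(ltW q0) //.
rewrite ler_pdivrMr // mulrC ler_pdivlMr // -intrM ler_int.
rewrite (reversed_cf_den a n j jn).
have := cfden_leS a ha (n - j); have := cfden_ge0 a ha (n - j).
have := cfden_ge0 _ hb j; have := cfden_ge1 _ hb j; nia.
Qed.

Theorem theorem1p3 (R : realType) (alpha : R) (halpha : irrational alpha) :
  exists C : R, 0 < C /\
    forall a : nat -> int, cf_expansion alpha a ->
    forall n : nat, (1 <= n)%N ->
      `| T alpha (cf_denominator a n) | <=
        (C * Num.max
               (ln (2 * (\big[Num.max/0]_(1 <= i < n.+1) a i)%:~R)
                  / (a n.+1)%:~R)
               1)%:C.
Proof.
(* 9737 = 9225 + 2 * 256: for a quotient a >= 1, (1 + L) / a <= 2 max(L / a, 1). *)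
exists 9737; split; first by rewrite ltr0n.
move=> a hexp n n1.
have ha : positive_quotients a by case: hexp.
set M := \big[Num.max/0]_(1 <= i < n.+1) a i.
set L := ln (2 * M%:~R).
pose b := reversed_cf a n.
have hb : positive_quotients b by exact: reversed_cf_positive.
have bM i : (1 <= i)%N -> b i <= M.
  by case: i => // i _; apply: quotient_le_bigmax; lia.
have M1 : 1 <= M by apply: le_trans (bM 1%N isT); exact: hb.
have M1R : 1 <= M%:~R :> R by rewrite ler1z.
have L0 : 0 <= L by apply: ln_ge0; lra.
pose Q j := `|cfden b j.+1|%N.
have QE j : (Q j)%:Z = cfden b j.+1.
  by rewrite gez0_abs // cfden_ge0.
have QR j : (Q j)%:R = (cfden b j.+1)%:~R :> R by rewrite -QE.
(* p_n q_{n-1} - p_{n-1} q_n = s, so s q_{n-1} is the inverse of p_n mod q_n. *)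
pose s : int := (-1) ^+ n.+1.
have ss : s * s = 1 by rewrite -expr2 sqrr_sign.
have qE := cf_denominatorE a ha n.
have q0 : (0 < cf_denominator a n)%N.
  by rewrite -ltz_nat qE (lt_le_trans _ (cfden_ge1 a ha n)).
have a1 : 1 <= (a n.+1)%:~R :> R by rewrite ler1z ha.
have qR : (cf_denominator a n)%:R = (cfden a n.+1)%:~R :> R by rewrite -qE.
have qS : cf_denominator a n = (cf_denominator a n).-1.+1 by rewrite prednK.
rewrite qS.
apply: (le_trans (T_bound R alpha
   (alpha - (cfnum a n.+1)%:~R / (cfden a n.+1)%:~R) (a n.+1)%:~R L
   (cfnum a n.+1) (s * cfden a n) (s * cfnum a n) (cf_denominator a n).-1 n Q
   (fun j => s * cfnum b j.+1) _ a1 _ _ _ _ _ _ L0 _ _ _ _)).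
- by rewrite -qS qR subrKC.
- by rewrite -qS qR; exact: cf_expansion_dist.
- rewrite -qS qE; have := cf_det a n; rewrite -/s => E.
  transitivity (s * (cfnum a n.+1 * cfden a n - cfnum a n * cfden a n.+1) +
                cfden a n.+1 * (s * cfnum a n)); first by ring.
  by rewrite E ss.
- by [].
- by move=> i; rewrite -ltz_nat QE (lt_le_trans _ (cfden_ge1 b hb i)).
- by move=> i; rewrite -lez_nat !QE cfden_leS.
- by move=> i; rewrite -lez_nat PoszM !QE cfden_double.
- move=> i; have Qi : 0 < (cfden b i.+1)%:~R :> R.
    by rewrite ltr0z (lt_le_trans _ (cfden_ge1 b hb i)).
  have Qi1 : 0 < (cfden b i.+2)%:~R :> R.
    by rewrite ltr0z (lt_le_trans _ (cfden_ge1 b hb i.+1)).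
  rewrite !QR /L ler_ln ?posrE ?divr_gt0 ?mulr_gt0 //; last by lra.
  rewrite ler_pdivrMr // -[2]/(2%:~R) -!intrM ler_int.
  exact: cfden_ratio_le.
- rewrite -qS; apply/eqP; rewrite -eqz_nat QE qE.
  rewrite (reversed_cf_den a n n (leqnn n)) subnn /= mulr1 mulr0 addr0.
  by [].
- move=> j _; rewrite QE; have /coprimezP[[x y] /= xy] := cf_coprime b j.
  apply/coprimezP; exists (x * s, y) => /=; rewrite -xy.
  by rewrite mulrA -[x * s * s]mulrA ss mulr1.
- move=> j jn; rewrite -qS qR QR.
  have -> : (cfden b j.+1)%:~R * ((s * cfden a n)%:~R / (cfden a n.+1)%:~R) -
     (s * cfnum b j.+1)%:~R =
    s%:~R * ((cfden b j.+1)%:~R * ((cfden a n)%:~R / (cfden a n.+1)%:~R) -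
     (cfnum b j.+1)%:~R) :> R by rewrite !intrM; ring.
  rewrite normrM /s rmorph_sign normrX normrN1 expr1n mul1r.
  by apply: reversed_cf_dist => //; exact: ltnW.
rewrite lecR.
set x := Num.max _ _.
have x1 : 1 <= x by rewrite le_max lexx orbT.
have xL : L / (a n.+1)%:~R <= x by rewrite le_max lexx.
have a1' : (a n.+1)%:~R^-1 <= 1 :> R by rewrite invf_le1 //; lra.
rewrite -mulrA mulrDl mul1r; lra.
Qed.
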